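(* Let $\mathbb P$ be a partition, $P_0$ a probability on $\mathcal A(\mathbb P)$, and let $a\in\mathbb R$, $b>0$ satisfy $b+2a\le 1$ and $a>0$. Put $c=1-(a+b)$ and let $(\underline P,\overline P)$ be the Restricted Range Model: $\underline P(A)=bP_0(A)+a$ and $\overline P(A)=bP_0(A)+c$ for all $A\in\mathcal A(\mathbb P)\setminus\{\emptyset,\Omega\}$, $\underline P(\emptyset)=\overline P(\emptyset)=0$, $\underline P(\Omega)=\overline P(\Omega)=1$. Then $\underline P$ and $\overline P$ are 2-coherent (as a lower, respectively upper, probability on $\mathcal A(\mathbb P)$), and they are coherent if and only if $|\mathbb P|=2$.
   Context: A partition $\mathbb P$ is a (finite or infinite) set of pairwise disjoint non-impossible events (atoms) whose logical sum is the sure event $\Omega$. $\mathcal A(\mathbb P)$ is the powerset of $\mathbb P$ (events are identified with sets of atoms); $\emptyset$ is the impossible event and $\neg A$ the complement of $A$. A probability on $\mathcal A(\mathbb P)$ is a finitely additive function $P_0:\mathcal A(\mathbb P)\to[0,1]$ with $P_0(\Omega)=1$ (no countable additivity is required). $I_A$ is the indicator of $A$; maxima of gains are over atoms; $\mathbb N$ includes $0$. A lower probability $\underline P:\mathcal A(\mathbb P)\to\mathbb R$ is 2-coherent if, for all $s_1\ge 0$, $s_0\in\mathbb R$ and $A_0,A_1\in\mathcal A(\mathbb P)$, $\max\big[s_1(I_{A_1}-\underline P(A_1))-s_0(I_{A_0}-\underline P(A_0))\big]\ge 0$. An upper probability $\overline P$ is 2-coherent if its conjugate $A\mapsto 1-\overline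 P(\neg A)$ is a 2-coherent lower probability. $\underline P$ is a coherent lower probability if for all $n\in\mathbb N$, $s_i\ge 0$, $A_i\in\mathcal A(\mathbb P)$ ($i=0,\dots,n$), $\max\big[\sum_{i=1}^n s_i(I_{A_i}-\underline P(A_i))-s_0(I_{A_0}-\underline P(A_0))\big]\ge 0$. $\overline P$ is a coherent upper probability if for all such $n,s_i,A_i$, $\max\big[\sum_{i=1}^n s_i(\overline P(A_i)-I_{A_i})-s_0(\overline P(A_0)-I_{A_0})\big]\ge 0$.
   Formalization: The equivalence ''coherent if and only if |P| = 2'' is stated for partitions with at least two atoms; for a one-atom partition all gains vanish, so both probabilities are coherent although |P| = 1. The 2-coherence claim is stated for every partition. *)

(* Defs.v *)
From mathcomp Require Import all_boot all_order all_algebra.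
From mathcomp Require Import all_classical all_reals numfun.

Set Implicit Arguments.
Unset Strict Implicit.
Unset Printing Implicit Defensive.

Import Order.TTheory GRing.Theory Num.Theory.
Local Open Scope classical_set_scope.
Local Open Scope ring_scope.

(* Throughout, [T : Type] is the (finite or infinite) set of atoms of the
   partition, and events are identified with sets of atoms: the sure event is
   [setT], the impossible event is [set0], the negation of [A] is [~` A].
   That there is at least one atom follows from the existence of a probability,
   since [P0 set0 = 0] and [P0 setT = 1]. *)

(* Finitely additive only. *)
Record is_probability (R : realType) (T : Type) (P0 : set T -> R) : Prop :=
  IsProbability {
    probability_itv : forall A, 0 <= P0 A <= 1;
    probability_setT : P0 setT = 1;
    probability_setU :
      forall A B, [disjoint A & B] -> P0 (A `|` B) = P0 A + P0 B }.

(* "max G >= 0": the maximum of [G] over the atoms is attained, and is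
   nonnegative. *)
Definition max_ge0 (R : realType) (T : Type) (G : T -> R) : Prop :=
  exists2 m, (range G `&` ubound (range G)) m & 0 <= m.

Definition coherent2_lower (R : realType) (T : Type) (lP : set T -> R) : Prop :=
  forall (s1 s0 : R) (A0 A1 : set T), 0 <= s1 ->
    max_ge0 (fun w => s1 * (\1_A1 w - lP A1) - s0 * (\1_A0 w - lP A0)).

Definition conjugate (R : realType) (T : Type) (P : set T -> R) : set T -> R :=
  fun A => 1 - P (~` A).

Definition coherent2_upper (R : realType) (T : Type) (uP : set T -> R) : Prop :=
  coherent2_lower (conjugate uP).

(* Only the values of [s] and [A] at [0, ..., n] matter. *)
Definition coherent_lower (R : realType) (T : Type) (lP : set T -> R) : Prop :=
  forall (n : nat) (s : nat -> R) (A : nat -> set T),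
    (forall i, (i <= n)%N -> 0 <= s i) ->
    max_ge0 (fun w => \sum_(1 <= i < n.+1) s i * (\1_(A i) w - lP (A i))
                      - s 0%N * (\1_(A 0%N) w - lP (A 0%N))).

Definition coherent_upper (R : realType) (T : Type) (uP : set T -> R) : Prop :=
  forall (n : nat) (s : nat -> R) (A : nat -> set T),
    (forall i, (i <= n)%N -> 0 <= s i) ->
    max_ge0 (fun w => \sum_(1 <= i < n.+1) s i * (uP (A i) - \1_(A i) w)
                      - s 0%N * (uP (A 0%N) - \1_(A 0%N) w)).

(* Restricted Range Model: affine transform of [P0], except at the impossible
   and the sure event. *)
Definition affine_model (R : realType) (T : Type) (P0 : set T -> R) (b d : R) :
    set T -> R :=
  fun A => if A == set0 then 0 else if A == setT then 1 else b * P0 A + d.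

Definition rrm_lower (R : realType) (T : Type) (P0 : set T -> R) (a b : R) :=
  affine_model P0 b a.

Definition rrm_upper (R : realType) (T : Type) (P0 : set T -> R) (a b : R) :=
  affine_model P0 b (1 - (a + b)).

(* Main.v *)
Require Import Defs.
From mathcomp Require Import all_boot all_order all_algebra.
From mathcomp Require Import all_classical all_reals numfun.
From mathcomp Require Import lra ring.
Local Open Scope classical_set_scope.
Local Open Scope card_scope.
Local Open Scope ring_scope.
Import Order.TTheory GRing.Theory Num.Theory.

(** Everything reduces to the lower probability: the conjugate of
    [rrm_upper P0 a b] is [rrm_lower P0 a b], and an upper probability is
    coherent exactly when its conjugate is, because the bet [uP A - \1_A]
    against [A] has the same gain as the bet in favour of [~` A] at the conjugate
    price.

    The lower probability [l] of the model is normalised, monotone, and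
    satisfies [l A + l (~` A) <= 1]; for a nontrivial [A] the last sum is
    [b + 2 * a].  These properties ([dominated_capacity]) rule out a sure loss
    from any two bets, since one can always name an atom at which the gain is
    nonnegative ([dominated_capacity_coherent2]).  When there are only two
    atoms they even give full coherence ([dominated_capacity_coherent]): the
    constraints [l [set x] <= q <= 1 - l [set y]] on the mass [q] of the first
    atom define a nonempty segment of probabilities that dominate [l], and each
    value of [l] is reached at one of its endpoints; the expectation of the gain
    under the endpoint that is exact on [A 0] is nonnegative, hence so is the
    gain at some atom.

    With a third atom, take two distinct atoms [x] and [y].  The event
    [[set x; y]] is still nontrivial, so the constant [a] is counted twice in
    [l [set x] + l [set y]] but once in [l [set x; y]].  Betting on [x] and on
    [y] and against their union then has the constant gain [- a], which is
    negative ([rrm_lower_coherent_two_atoms]).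

    Gains take finitely many values even on an infinite partition, so that
    their maxima are attained ([max_ge0_fin]). *)

(** * Gains with finitely many values *)

Lemma max_ge0_fin {R : realType} {T : Type} {X : finType} (h : T -> X)
    (F : X -> R) (w : T) :
  0 <= F (h w) -> max_ge0 (fun t => F (h t)).
Proof.
move=> Fw0.
have Pw : `[< exists t, h t = h w >] by apply/asboolP; exists w.
case: (@arg_maxP _ _ _ _ (fun i => `[< exists t, h t = i >]) F Pw).
move=> i /asboolP[t hti] maxF.
exists (F i); last exact: le_trans Fw0 (maxF _ Pw).
split; first by exists t; rewrite ?hti.
by move=> _ [u _ <-]; apply: maxF; apply/asboolP; exists u.
Qed.

(** * Capacities dominated by their conjugate *)

(** On a powerset these properties are exactly 2-coherence; the last one is
    [l <= conjugate l]. *)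
Record dominated_capacity {R : realType} {T : Type} (l : set T -> R) : Prop :=
  DominatedCapacity {
    capacity_set0 : l set0 = 0;
    capacity_setT : l setT = 1;
    capacity_mono : forall A B, A `<=` B -> l A <= l B;
    capacity_setC : forall A, l A + l (~` A) <= 1 }.

Arguments capacity_set0 {R T l}.
Arguments capacity_setT {R T l}.
Arguments capacity_mono {R T l} _ {A B}.
Arguments capacity_setC {R T l}.

Section DominatedCapacity.
Context {R : realType} {T : Type} {l : set T -> R}.
Hypothesis lP : dominated_capacity l.

Let l_ge0 A : 0 <= l A.
Proof. by rewrite -(capacity_set0 lP); apply: capacity_mono. Qed.

Let l_le1 A : l A <= 1.
Proof. by rewrite -(capacity_setT lP); apply: capacity_mono. Qed.

(** The atom is sought where the bets are won.  Bets on opposite sides with [A1]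
    not included in [A0], or on the same side with [A1] meeting [A0], are both
    won at some atom.  A bet that is won nowhere, on [set0] or against [setT],
    has zero gain and leaves a single bet.  Otherwise monotonicity gives
    [l A1 <= l A0], respectively [l A1 <= l (~` A0) <= 1 - l A0], and an atom at
    which the bet with the larger stake is won will do. *)
Lemma dominated_capacity_gain_ge0 (s1 s0 : R) (A0 A1 : set T) (w0 : T) :
  0 <= s1 -> exists w, 0 <= s1 * (\1_A1 w - l A1) - s0 * (\1_A0 w - l A0).
Proof.
move=> s1_ge0; have := (l_ge0 A0, l_le1 A0, l_ge0 A1, l_le1 A1).
move=> [[[l0_ge0 l0_le1] l1_ge0] l1_le1].
have [s0_ge0|s0_lt0] := leP 0 s0.
- have [sA|/nonsubset[w [A1w A0w]]] := pselect (A1 `<=` A0); last first.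
    exists w; rewrite !indicE mem_set// memNset//=; nra.
  have l10 := capacity_mono lP sA.
  have [A1e|/set0P[w1 A1w1]] := eqVneq A1 set0.
    rewrite {}A1e (capacity_set0 lP) indic0 /cst {sA l10 l1_ge0 l1_le1}.
    have [->|/setTPn[w A0w]] := eqVneq A0 setT.
      by exists w0; rewrite (capacity_setT lP) indicT /cst /=; lra.
    by exists w; rewrite !indicE memNset//=; nra.
  have [A0T|/setTPn[w A0w]] := eqVneq A0 setT.
    exists w1; rewrite A0T (capacity_setT lP) indicT /cst indicE mem_set//=.
    by nra.
  have nA1w : ~ A1 w by move=> /sA.
  have [s01|s10] := leP s0 s1.
    by exists w1; rewrite !indicE !mem_set//=; [nra|exact: sA].
  by exists w; rewrite !indicE !memNset//=; nra.
- have [[w [A1w A0w]]|nI] := pselect (A1 `&` A0 !=set0).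
    by exists w; rewrite !indicE !mem_set//=; nra.
  have sA : A1 `<=` ~` A0 by move=> t A1t A0t; apply: nI; exists t.
  have l10 := capacity_mono lP sA; have lC := capacity_setC lP A0.
  have [A0e|/set0P[w A0w]] := eqVneq A0 set0.
    rewrite A0e (capacity_set0 lP) indic0 /cst.
    have [->|/set0P[w1 A1w1]] := eqVneq A1 set0.
      by exists w0; rewrite (capacity_set0 lP) indic0 /cst /=; lra.
    by exists w1; rewrite indicE mem_set//=; nra.
  have nA1w : ~ A1 w by move=> /sA.
  have [A1e|/set0P[w1 A1w1]] := eqVneq A1 set0.
    exists w; rewrite A1e (capacity_set0 lP) indic0 /cst indicE mem_set//=; nra.
  have [s01|s10] := leP (- s0) s1.
    by exists w1; rewrite !indicE mem_set// memNset /=; [nra|exact: sA].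
  by exists w; rewrite !indicE memNset// mem_set//=; nra.
Qed.

Lemma dominated_capacity_coherent2 : coherent2_lower l.
Proof.
move=> s1 s0 A0 A1 s1_ge0.
have [w0 _] : [set: T] !=set0.
  apply/set0P/eqP => T0; have := capacity_setT lP.
  by rewrite T0 (capacity_set0 lP) => /esym/eqP; rewrite oner_eq0.
have [w Gw] := dominated_capacity_gain_ge0 s1 s0 A0 A1 w0 s1_ge0.
exact: (max_ge0_fin (fun t => (t \in A0, t \in A1))
  (fun p : bool * bool => s1 * (p.2%:R - l A1) - s0 * (p.1%:R - l A0)) w).
Qed.

(** With two atoms only the singletons carry information, and any mass [q] of
    [x] between [l [set x]] and [1 - l [set y]] yields a probability above [l].
    Taking the expectation of the gain under a [q] that is exact on [A 0] leaves
    only nonnegative terms. *)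
Lemma dominated_capacity_coherent (x y : T) :
  x <> y -> (forall z, z = x \/ z = y) -> coherent_lower l.
Proof.
move=> xy Txy n s A s_ge0.
have memT (B : set T) : B x -> B y -> B = setT.
  by move=> Bx By; apply/seteqP; split=> // z _; case: (Txy z) => ->.
have memx (B : set T) : B x -> ~ B y -> B = [set x].
  by move=> Bx By; apply/seteqP; split=> [z Bz|_ ->//]; case: (Txy z) Bz => ->.
have memy (B : set T) : ~ B x -> B y -> B = [set y].
  by move=> Bx By; apply/seteqP; split=> [z Bz|_ ->//]; case: (Txy z) Bz => ->.
have mem0 (B : set T) : ~ B x -> ~ B y -> B = set0.
  by move=> Bx By; apply/seteqP; split=> // z Bz; case: (Txy z) Bz => ->.
have lxy : l [set x] + l [set y] <= 1.
  have <- : ~` [set x] = [set y] by apply: memy => /= [/(_ erefl)|/esym].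
  exact: capacity_setC.
have [lx_ge0 ly_ge0] := (l_ge0 [set x], l_ge0 [set y]).
pose Q q (B : set T) : R := q * \1_B x + (1 - q) * \1_B y.
have l_leQ q (B : set T) : l [set x] <= q -> q <= 1 - l [set y] -> l B <= Q q B.
  move=> lq ql; rewrite /Q !indicE.
  have [Bx|Bx] := pselect (B x); have [By|By] := pselect (B y).
  - by rewrite (memT B)// (capacity_setT lP) !in_setT/=; lra.
  - by rewrite mem_set// memNset//= (memx B)//; lra.
  - by rewrite memNset// mem_set//= (memy B)//; lra.
  - by rewrite !memNset//= (mem0 B)// (capacity_set0 lP); lra.
have [q [lq ql lA0]] : exists q, [/\ l [set x] <= q, q <= 1 - l [set y]
    & l (A 0%N) = Q q (A 0%N)].
  rewrite /Q; move: (A 0%N) => B.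
  have [Bx|Bx] := pselect (B x); have [By|By] := pselect (B y).
  - exists (l [set x]); rewrite (memT B)// (capacity_setT lP) indicT /cst /=.
    by split; lra.
  - exists (l [set x]); rewrite !indicE mem_set// memNset//= (memx B)//.
    by split; lra.
  - exists (1 - l [set y]); rewrite !indicE memNset// mem_set//= (memy B)//.
    by split; lra.
  - exists (l [set x]); rewrite (mem0 B)// (capacity_set0 lP) indic0 /cst /=.
    by split; lra.
set G := (G in max_ge0 G).
have EG : 0 <= q * G x + (1 - q) * G y.
  have -> : q * G x + (1 - q) * G y =
      \sum_(1 <= i < n.+1) s i * (Q q (A i) - l (A i)).
    rewrite /G !mulrBr !mulr_sumr addrACA -big_split /= [X in _ + X](_ : _ = 0).
      by rewrite addr0; apply: eq_bigr => i _; rewrite /Q; ring.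
    by rewrite lA0 /Q; ring.
  rewrite big_nat; apply: sumr_ge0 => i /andP[_ ilen].
  by rewrite mulr_ge0 ?s_ge0// subr_ge0 l_leQ.
pose F (c : bool) := if c then G x else G y.
have -> : G = (fun t => F `[< t = x >]).
  apply/funext => t; case: asboolP => [->//|tx].
  by case: (Txy t) => // ->.
(* A nonnegative expectation forces a nonnegative gain at one of the atoms. *)
have [Gx|Gx] := leP 0 (G x).
  by apply: (max_ge0_fin (fun t => `[< t = x >]) F x); case: asboolP.
apply: (max_ge0_fin (fun t => `[< t = x >]) F y); case: asboolP => [/esym//|_].
rewrite /F leNgt; apply/negP => Gy {xy Txy memT memx memy mem0}.
move: (G x) (G y) Gx Gy EG => gx gy Gx Gy EG.
by nra.
Qed.

End DominatedCapacity.

(** * Conjugation *)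

Lemma coherent_upper_conjugate {R : realType} {T : Type} (uP : set T -> R) :
  coherent_upper uP <-> coherent_lower (conjugate uP).
Proof.
have setCfun (s : nat -> R) (A : nat -> set T) n :
    (fun w => \sum_(1 <= i < n.+1) s i * (\1_(A i) w - conjugate uP (A i))
              - s 0%N * (\1_(A 0%N) w - conjugate uP (A 0%N))) =
    (fun w => \sum_(1 <= i < n.+1) s i * (uP (~` A i) - \1_(~` A i) w)
              - s 0%N * (uP (~` A 0%N) - \1_(~` A 0%N) w)).
  have gainC (B : set T) w :
      \1_B w - conjugate uP B = uP (~` B) - \1_(~` B) w.
    by rewrite /conjugate indicC indicE; case: (w \in B) => /=; ring.
  by apply/funext => w; rewrite gainC; under eq_bigr do rewrite gainC.
split=> coh n s A s_ge0.
  by rewrite setCfun; exact: (coh n s (fun i => ~` A i)).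
have := coh n s (fun i => ~` A i) s_ge0; rewrite setCfun.
by under eq_fun do (rewrite setCK; under eq_bigr do rewrite setCK).
Qed.

(** * The Restricted Range Model *)

Section RestrictedRange.
Context {R : realType} {T : Type} {P0 : set T -> R}.
Hypothesis hP0 : is_probability P0.

Let setT_neq0 : [set: T] != set0.
Proof.
apply/eqP => T0; have := @probability_setU _ _ _ hP0 set0 set0.
rewrite disj_set2E setI0 eqxx setU0 -T0 (probability_setT hP0).
by move=> /(_ isT); lra.
Qed.

Let P0_setC A : P0 (~` A) = 1 - P0 A.
Proof.
have dA : [disjoint A & ~` A] by rewrite disj_set2E setICr.
have := probability_setU hP0 dA; rewrite setUv (probability_setT hP0); lra.
Qed.

Let P0_mono A B : A `<=` B -> P0 A <= P0 B.
Proof.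
move=> AB; have dA : [disjoint A & B `\` A] by rewrite disj_set2E setDIK.
have := probability_setU hP0 dA; rewrite (setDUK AB) => ->.
by rewrite lerDl; case/andP: (probability_itv hP0 (B `\` A)).
Qed.

Lemma affine_modelE (b d : R) (A : set T) :
  A != set0 -> A != setT -> affine_model P0 b d A = b * P0 A + d.
Proof. by rewrite /affine_model => /negbTE -> /negbTE ->. Qed.

Lemma affine_model0 (b d : R) : affine_model P0 b d set0 = 0.
Proof. by rewrite /affine_model eqxx. Qed.

Lemma affine_modelT (b d : R) : affine_model P0 b d setT = 1.
Proof. by rewrite /affine_model (negbTE setT_neq0) eqxx. Qed.

Let setC_eq0 (A : set T) : (~` A == set0) = (A == setT).
Proof. by rewrite -setCT (inj_eq (can_inj setCK)). Qed.

Let setC_eqT (A : set T) : (~` A == setT) = (A == set0).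
Proof. by rewrite -setC0 (inj_eq (can_inj setCK)). Qed.

Lemma conjugate_rrm_upper (a b : R) :
  conjugate (rrm_upper P0 a b) = rrm_lower P0 a b.
Proof.
apply/funext => A; rewrite /conjugate /rrm_upper /rrm_lower.
have [->|A0] := eqVneq A set0.
  by rewrite setC0 affine_modelT affine_model0 subrr.
have [->|AT] := eqVneq A setT.
  by rewrite setCT affine_modelT affine_model0 subr0.
by rewrite !affine_modelE ?setC_eq0 ?setC_eqT// P0_setC; ring.
Qed.

Lemma rrm_lower_dominated (a b : R) :
  0 < b -> b + 2 * a <= 1 -> 0 < a -> dominated_capacity (rrm_lower P0 a b).
Proof.
move=> hb hab ha; have P0_itv A := andP (probability_itv hP0 A).
rewrite /rrm_lower; split=> [||A B AB|A].
- exact: affine_model0.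
- exact: affine_modelT.
- have [A0|A0] := eqVneq A set0.
    rewrite A0 affine_model0 /affine_model.
    case: ifP => // _; case: ifP => // _.
    by case: (P0_itv B) => P_ge0 _; rewrite addr_ge0 ?mulr_ge0// ltW.
  have B0 : B != set0.
    by apply: contra_neq A0 => B0; move: AB; rewrite B0 subset0.
  have [->|BT] := eqVneq B setT.
    rewrite affine_modelT /affine_model; case: ifP => // _; case: ifP => // _.
    case: (P0_itv A) => _ P_le1.
    by have := ler_piMr (ltW hb) P_le1; lra.
  have AT : A != setT.
    by apply: contra_neq BT => AT; move: AB; rewrite AT subTset.
  by rewrite !affine_modelE// lerD2r ler_pM2l// P0_mono.
- have [->|A0] := eqVneq A set0.
    by rewrite setC0 affine_modelT affine_model0 add0r.
  have [->|AT] := eqVneq A setT.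
    by rewrite setCT affine_modelT affine_model0 addr0.
  by rewrite !affine_modelE ?setC_eq0 ?setC_eqT// P0_setC; lra.
Qed.

(** Pairwise bets never reveal this failure: it takes three events.  A third
    atom [z] keeps [[set x; y]] away from [setT], so that
    superadditivity fails by [a] on the pair [[set x]], [[set y]]. *)
Lemma rrm_lower_coherent_two_atoms (a b : R) (x y : T) :
  0 < a -> x <> y -> coherent_lower (rrm_lower P0 a b) ->
  forall z, z = x \/ z = y.
Proof.
move=> ha xy coh z; apply: contrapT => /not_orP[zx zy].
have lE (t : T) (A : set T) : A t -> ~ A z -> rrm_lower P0 a b A = b * P0 A + a.
  move=> At Az; apply: affine_modelE; first by apply/set0P; exists t.
  by apply/eqP => AT; apply: Az; rewrite AT.
pose A i := nth set0 [:: [set x; y]; [set x]; [set y]] i.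
have [m [[w _ <-] _]] := coh 2 (fun=> 1) A (fun _ _ => ler01).
rewrite big_nat_recl// big_nat1 /A /= !mul1r.
rewrite (lE x [set x; y])//=; [|by left|by case].
rewrite (lE x [set x])// (lE y [set y])//.
have dxy : [disjoint [set x] & [set y]].
  by rewrite disj_set2E; apply/eqP/seteqP; split=> // t [/= -> /xy].
rewrite (probability_setU hP0)// !indicE in_setU.
have nxy : ~~ ((w \in [set x]) && (w \in [set y])).
  by apply/negP => /andP[]; rewrite !in_setE /= => -> /xy.
by case: (w \in [set x]) nxy; case: (w \in [set y]) => //= _; lra.
Qed.

End RestrictedRange.

(** * Partitions with two atoms *)

Lemma card_eq_I2P {T : Type} : ([set: T] #= `I_2)%card <->
  exists x y : T, x <> y /\ forall z, z = x \/ z = y.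
Proof.
split=> [/card_set_bijP[f [fI finj fsurj]]|[x [y [xy Txy]]]].
  have [x _ fx] := fsurj 0%N isT; have [y _ fy] := fsurj 1%N isT.
  exists x, y; split=> [xy|z]; first by move: fy; rewrite -xy fx.
  have := fI z I; rewrite /=; case fz: (f z) => [|[|//]] _; [left|right];
    by apply: finj; rewrite ?in_setT// fz.
apply/card_set_bijP; exists (fun z => if `[< z = x >] then 0%N else 1%N); split.
- by move=> z _ /=; case: ifP.
- move=> u v _ _; case: asboolP => [->|ux]; case: asboolP => [->|vx]//.
  by case: (Txy u) => // ->; case: (Txy v).
- move=> [|[|//]] _; first by exists x => //; case: asboolP.
  by exists y => //; case: asboolP => // /esym.
Qed.

Lemma card_ge_I2_neq {T : Type} :
  (`I_2 #<= [set: T])%card -> exists x y : T, x <> y.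
Proof.
move=> T2; apply: contrapT => nxy.
suff : (`I_2 #<= `I_1)%card by rewrite card_le_II.
have [T0|/set0P[x _]] := eqVneq [set: T] set0.
  by apply: card_le_trans T2 _; rewrite T0; exact: card_ge0.
have -> : (`I_2 #<= `I_1)%card = (`I_2 #<= [set x])%card.
  by apply/esym; apply: card_le_eqr; exact: card_set1.
apply: card_le_trans T2 (subset_card_le _) => y _ /=.
by apply: contrapT => yx; apply: nxy; exists y, x.
Qed.

Theorem proposition6p1 (R : realType) (T : Type) (P0 : set T -> R) (a b : R)
    (hP0 : is_probability P0) (hb : 0 < b) (hab : b + 2 * a <= 1) (ha : 0 < a) :
  (coherent2_lower (rrm_lower P0 a b) /\ coherent2_upper (rrm_upper P0 a b)) /\
  ((`I_2 #<= [set: T])%card ->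
    (coherent_lower (rrm_lower P0 a b) <-> ([set: T] #= `I_2)%card) /\
    (coherent_upper (rrm_upper P0 a b) <-> ([set: T] #= `I_2)%card)).
Proof.
rewrite coherent_upper_conjugate /coherent2_upper (conjugate_rrm_upper hP0).
have lP := rrm_lower_dominated hP0 a b hb hab ha.
have coh2 := dominated_capacity_coherent2 lP.
split=> // T2; suff cohP : coherent_lower (rrm_lower P0 a b) <->
  ([set: T] #= `I_2)%card by [].
rewrite card_eq_I2P; split=> [coh|[x [y [xy Txy]]]].
- have [x [y xy]] := card_ge_I2_neq T2; exists x, y; split=> //.
  exact: (rrm_lower_coherent_two_atoms hP0 a b x y ha xy coh).
- exact: (dominated_capacity_coherent lP x y).
Qed.
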